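(* Let $\mathbf{Ab}$ be the variety of all Abelian groups. A finite connected directed graph $\Gamma$ contains a breaking path over $\mathbf{Ab}$ if and only if $\Theta_1$ or $\Theta_2$ is a minor of $\Gamma$, where: $\Theta_1$ has vertices $u,v,w$ and edges $a,b$ from $u$ to $v$, $c$ from $w$ to $u$, and $d$ from $w$ to $v$; and $\Theta_2$ has vertices $u,v,w$ and edges $a,b$ from $u$ to $v$ and $c,d$ from $w$ to $u$.
   Context: All graphs are finite directed graphs, possibly with loops and multiple edges. A graph $\Gamma$ has vertex set $V(\Gamma)$ and edge set $E(\Gamma)$, and each edge $e$ has an initial vertex $\iota e$ and a terminal vertex $\tau e$. A subgraph is regarded as a set of vertices and edges (containing the endpoints of its edges); unions and intersections of subgraphs are taken as sets of vertices and edges. Connectedness refers to the underlying undirected graph. Let $\overline{\Gamma}$ be the graph with vertex set $V(\Gamma)$ and edge set $E(\Gamma)\sqcup E(\Gamma)^{-1}$, where for $e\in E(\Gamma)$ the formal edge $e^{-1}$ goes from $\tau e$ to $\iota e$. A path $p$ in $\overline{\Gamma}$ is either an empty path at a vertex or a sequence $e_1\cdots e_n$ of edges of $\overline{\Gamma}$ with $\tau e_i=\iota e_{i+1}$; it has initial vertex $\iota p$ and terminal vertex $\tau p$, and is regarded as a word over the alphabet $E(\Gamma)\cup E(\Gamma)^{-1}$. The span $\langle p\rangle$ is the subgraph of $\Gamma$ consisting of the vertices traversed by $p$ and the edges $e\in E(\Gamma)$ such that $e$ or $e^{-1}$ occurs in $p$. For a group variety $\mathbf{U}$ and words $u,v$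 over $X\cup X^{-1}$, write $u\equiv_{\mathbf U} v$ if $u$ and $v$ represent the same element of the relatively free group of $\mathbf U$ on $X$ (i.e. the identity $u=v$ holds in $\mathbf U$), and $[u]_{\mathbf U}$ for the class of $u$. The free $g\mathbf U$-category on $\Gamma$ has vertex set $V(\Gamma)$; its arrows from $i$ to $j$ are the triples $(i,[p]_{\mathbf U},j)$ with $p$ an $(i,j)$-path in $\overline\Gamma$, and $(i,[p]_{\mathbf U},j)(j,[q]_{\mathbf U},k)=(i,[pq]_{\mathbf U},k)$; for an arrow $x=(i,[p]_{\mathbf U},j)$ put $\iota x=i$, $\tau x=j$. For each arrow $x$ define subgraphs of $\Gamma$: $C_0(x)=\bigcap\{\langle p\rangle : p \text{ a path in }\overline\Gamma \text{ with } (\iota p,[p]_{\mathbf U},\tau p)=x\}$; $P_n(x)$ is the connected component of $C_n(x)$ containing $\iota x$; $C_{n+1}(x)=\bigcap\{P_n(x_1)\cup\cdots\cup P_n(x_k) : k\ge 1,\ x_1,\dots,x_k \text{ arrows with } x_1\cdots x_k=x\}$; and $P(x)=\bigcap_{n\ge 0}P_n(x)$. For a connected graph $\Gamma$, a path $p$ in $\overline\Gamma$ is a breaking path over $\mathbf U$ if $\tau p\notin P(x)$ where $x=(\iota p,[p]_{\mathbf U},\tau p)$. A graph $\Delta$ is a minor of $\Gamma$ if $\Delta$ can be obtained from $\Gamma$ by a finite sequence of the following operations: contracting an edge $e$ with $\iota e\neq\tau e$ (removing $e$ and identifying its two endpoints into one vertex), deleting an edge, deleting a vertex together with its incident edges,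 and reversing the direction of an edge. (In particular the directions of the edges of $\Theta_1,\Theta_2$ are immaterial.) *)

(* Defs.v *)
From HB Require Import structures.
From Stdlib Require List.
From mathcomp Require Import all_boot all_algebra.
Set Implicit Arguments. Unset Strict Implicit. Unset Printing Implicit Defensive.
Import GRing.Theory.
Local Open Scope ring_scope.

Record graph := Graph {
  gV : finType;
  gE : finType;
  gsrc : gE -> gV;
  gtgt : gE -> gV
}.

Section Paths.
Variable G : graph.

(** An edge of Gbar: (e, true) is e, (e, false) is e^{-1}. *)
Definition sedge := (gE G * bool)%type.
Definition sinit (x : sedge) : gV G := if x.2 then gsrc x.1 else gtgt x.1.
Definition sterm (x : sedge) : gV G := if x.2 then gtgt x.1 else gsrc x.1.

Fixpoint is_walk (v : gV G) (w : seq sedge) : bool :=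
  match w with
  | [::] => true
  | x :: w' => (sinit x == v) && is_walk (sterm x) w'
  end.

Fixpoint wend (v : gV G) (w : seq sedge) : gV G :=
  match w with
  | [::] => v
  | x :: w' => wend (sterm x) w'
  end.

Record gpath := GPath { pstart : gV G; pwalk : seq sedge;
                        pvalid : is_walk pstart pwalk }.
Definition pend (p : gpath) : gV G := wend (pstart p) (pwalk p).

Definition evalw (A : zmodType) (f : gE G -> A) (w : seq sedge) : A :=
  \sum_(x <- w) (if x.2 then f x.1 else - f x.1).

Definition abeq (u v : seq sedge) : Prop :=
  forall (A : zmodType) (f : gE G -> A), evalw f u = evalw f v.

(** p and q define the same arrow (iota p, [p]_Ab, tau p) of the free gAb-category. *)
Definition same_arrow (p q : gpath) : Prop :=
  pstart p = pstart q /\ pend p = pend q /\ abeq (pwalk p) (pwalk q).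

Record subg := Subg { sV : gV G -> Prop; sE : gE G -> Prop }.

Definition span (p : gpath) : subg :=
  Subg (fun v => v = pstart p \/ exists2 x, List.In x (pwalk p) & v = sterm x)
       (fun e => exists b, List.In (e, b) (pwalk p)).

Definition conn_in (S : subg) (a v : gV G) : Prop :=
  exists w, [/\ is_walk a w, wend a w = v, sV S a &
                forall x, List.In x w -> sE S x.1 /\ sV S (sterm x)].

Definition component (S : subg) (a : gV G) : subg :=
  Subg (fun v => conn_in S a v)
       (fun e => [/\ sE S e, conn_in S a (gsrc e) & conn_in S a (gtgt e)]).

Definition C0 (p : gpath) : subg :=
  Subg (fun v => forall q, same_arrow q p -> sV (span q) v)
       (fun e => forall q, same_arrow q p -> sE (span q) e).

Fixpoint chained (ps : seq gpath) : bool :=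
  match ps with
  | p :: ((q :: _) as ps') => (pend p == pstart q) && chained ps'
  | _ => true
  end.

Definition factorization (ps : seq gpath) (p : gpath) : Prop :=
  match ps with
  | [::] => False
  | p1 :: _ =>
      [/\ chained ps, pstart p1 = pstart p,
          pend (last p1 ps) = pend p &
          abeq (flatten (map pwalk ps)) (pwalk p)]
  end.

Definition Cnext (Pn : gpath -> subg) (p : gpath) : subg :=
  Subg (fun v => forall ps, factorization ps p ->
                   exists2 q, List.In q ps & sV (Pn q) v)
       (fun e => forall ps, factorization ps p ->
                   exists2 q, List.In q ps & sE (Pn q) e).

Fixpoint Cn (n : nat) (p : gpath) : subg :=
  match n with
  | 0 => C0 p
  | n'.+1 => Cnext (fun q => component (Cn n' q) (pstart q)) p
  end.

Definition Pn (n : nat) (p : gpath) : subg := component (Cn n p) (pstart p).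

Definition Pinf (p : gpath) : subg :=
  Subg (fun v => forall n, sV (Pn n p) v) (fun e => forall n, sE (Pn n p) e).

Definition breaking (p : gpath) : Prop := ~ sV (Pinf p) (pend p).

Definition connected_graph : Prop :=
  forall u v : gV G, exists w, is_walk u w /\ wend u w = v.

End Paths.

Definition graph_iso (D G : graph) : Prop :=
  exists (fV : gV D -> gV G) (fE : gE D -> gE G),
    [/\ bijective fV, bijective fE &
        forall d, gsrc (fE d) = fV (gsrc d) /\ gtgt (fE d) = fV (gtgt d)].

Definition del_edge_step (D G : graph) : Prop :=
  exists (e : gE G) (fV : gV D -> gV G) (fE : gE D -> gE G),
    [/\ bijective fV, injective fE,
        (forall e', e' <> e <-> exists d, fE d = e') &
        forall d, gsrc (fE d) = fV (gsrc d) /\ gtgt (fE d) = fV (gtgt d)].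

Definition del_vertex_step (D G : graph) : Prop :=
  exists (v : gV G) (fV : gV D -> gV G) (fE : gE D -> gE G),
    [/\ injective fV, (forall v', v' <> v <-> exists d, fV d = v'),
        injective fE,
        (forall e', (gsrc e' <> v /\ gtgt e' <> v) <-> exists d, fE d = e') &
        forall d, gsrc (fE d) = fV (gsrc d) /\ gtgt (fE d) = fV (gtgt d)].

Definition reverse_step (D G : graph) : Prop :=
  exists (e : gE G) (fV : gV D -> gV G) (fE : gE D -> gE G),
    [/\ bijective fV, bijective fE &
        forall d, if fE d == e
                  then gsrc (fE d) = fV (gtgt d) /\ gtgt (fE d) = fV (gsrc d)
                  else gsrc (fE d) = fV (gsrc d) /\ gtgt (fE d) = fV (gtgt d)].

Definition contract_step (D G : graph) : Prop :=
  exists (e : gE G) (phi : gV G -> gV D) (fE : gE D -> gE G),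
    gsrc e <> gtgt e /\
    [/\ (forall y, exists x, phi x = y),
        (forall x y, phi x = phi y <->
           (x = y \/ (x = gsrc e /\ y = gtgt e) \/ (x = gtgt e /\ y = gsrc e))),
        injective fE,
        (forall e', e' <> e <-> exists d, fE d = e') &
        forall d, gsrc d = phi (gsrc (fE d)) /\ gtgt d = phi (gtgt (fE d))].

Definition minor_step (D G : graph) : Prop :=
  [\/ del_edge_step D G, del_vertex_step D G, reverse_step D G | contract_step D G].

Inductive minor : graph -> graph -> Prop :=
  | minor_refl D G : graph_iso D G -> minor D G
  | minor_trans D H G : minor_step D H -> minor H G -> minor D G.

(** Theta_1 and Theta_2: vertices u = 0, v = 1, w = 2; edges a = 0, b = 1, c = 2, d = 3. *)
Definition tu : 'I_3 := inord 0.
Definition tv : 'I_3 := inord 1.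
Definition tw : 'I_3 := inord 2.

Definition theta1_src (e : 'I_4) : 'I_3 :=
  match val e with 0 | 1 => tu | _ => tw end.
Definition theta1_tgt (e : 'I_4) : 'I_3 :=
  match val e with 0 | 1 => tv | 2 => tu | _ => tv end.
Definition Theta1 : graph := @Graph 'I_3 'I_4 theta1_src theta1_tgt.

Definition theta2_src (e : 'I_4) : 'I_3 :=
  match val e with 0 | 1 => tu | _ => tw end.
Definition theta2_tgt (e : 'I_4) : 'I_3 :=
  match val e with 0 | 1 => tv | _ => tu end.
Definition Theta2 : graph := @Graph 'I_3 'I_4 theta2_src theta2_tgt.

(* Main.v *)
(** For Abelian groups the arrow of a path is determined by its ends and the
    signed number of times it uses each edge, so minors lift: in a model of [D]
    in [G] whose branch sets are contracted along a forest, every path of [D]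
    lifts to [G] with prescribed ends in the branch sets, equal arrows lift to
    equal arrows, and [P_n] of a lift lies over [P_n] of the path. Hence breaking
    paths of [D] lift to [G], and in both Theta graphs the path [c a] breaks.

    Conversely, call edges [e], [f] a theta pair if they are neither loops nor
    parallel and [G - {e, f}] is connected. A theta pair survives the contraction
    of an edge crossing a vertex set that neither [e] nor [f] crosses; on three
    vertices it spans Theta_1 or Theta_2. If there is no theta pair, induction
    on [n] shows that [P_n x] contains the end of [x] and all non-loop edges of
    nonzero exponent in [x]. *)
From mathcomp Require Import all_boot all_algebra boolp.
Require Import Defs.
Set Implicit Arguments. Unset Strict Implicit. Unset Printing Implicit Defensive.
Import GRing.Theory.
Local Open Scope ring_scope.

Lemma InP (T : eqType) (x : T) (s : seq T) : reflect (List.In x s) (x \in s).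
Proof.
elim: s => [|y s IH] /=; first by constructor.
rewrite inE; apply: (iffP orP) => [[/eqP->|/IH]|[->|/IH]]; by [left|right|rewrite eqxx; left].
Qed.

(** * Walks, their evaluations, and components of subgraphs *)

Section Walks.
Variable G : graph.
Implicit Types (v : gV G) (w : seq (sedge G)) (S : subg G).

Lemma is_walk_cat v w1 w2 :
  is_walk v (w1 ++ w2) = is_walk v w1 && is_walk (wend v w1) w2.
Proof. by elim: w1 v => //= x w1 IH v; rewrite IH andbA. Qed.

Lemma wend_cat v w1 w2 : wend v (w1 ++ w2) = wend (wend v w1) w2.
Proof. by elim: w1 v => /=. Qed.

Lemma wend_rcons v w x : wend v (rcons w x) = sterm x.
Proof. by rewrite -cats1 wend_cat. Qed.

Lemma evalw_nil (A : zmodType) (f : gE G -> A) : evalw f [::] = 0.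
Proof. by rewrite /evalw big_nil. Qed.

Lemma evalw_cons (A : zmodType) (f : gE G -> A) x w :
  evalw f (x :: w) = (if x.2 then f x.1 else - f x.1) + evalw f w.
Proof. by rewrite /evalw big_cons. Qed.

Lemma evalw_cat (A : zmodType) (f : gE G -> A) w1 w2 :
  evalw f (w1 ++ w2) = evalw f w1 + evalw f w2.
Proof. by rewrite /evalw big_cat. Qed.

(** The sum telescopes along the walk. It serves both to normalize evaluations on contracted edges
    and, with an indicator as [h], to read exponents as a flow. *)
Lemma evalw_potential (A : zmodType) (h : gV G -> A) v w : is_walk v w ->
  evalw (fun g => h (gtgt g) - h (gsrc g)) w = h (wend v w) - h v.
Proof.
elim: w v => [|x w IH] v /=; first by rewrite evalw_nil subrr.
case/andP=> /eqP <- /IH; rewrite evalw_cons => ->.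
rewrite /sinit /sterm; case: x.2; first by rewrite addrC addrA subrK.
by rewrite opprB addrC addrA subrK.
Qed.

Lemma evalwB (A : zmodType) (f g : gE G -> A) w :
  evalw (fun e => f e - g e) w = evalw f w - evalw g w.
Proof.
rewrite /evalw -sumrB; apply: eq_bigr => x _.
by case: x.2 => //; rewrite opprB opprK addrC.
Qed.

Lemma conn_in_refl S v : sV S v -> conn_in S v v.
Proof. by move=> Sv; exists [::]; split. Qed.

Lemma conn_in_start S a v : conn_in S a v -> sV S a.
Proof. by case=> w []. Qed.

Lemma conn_in_step S a x :
  conn_in S a (sinit x) -> sE S x.1 -> sV S (sterm x) -> conn_in S a (sterm x).
Proof.
case=> w [ww we Sa Sw] Sx Sx'; exists (rcons w x); split=> //.
- by rewrite -cats1 is_walk_cat ww we /= eqxx.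
- by rewrite wend_rcons.
- by move=> y /InP; rewrite mem_rcons inE => /orP[/eqP->|/InP /Sw].
Qed.

(** Walks are read from their last edge, since every prefix of a walk in [S] from [a] is again such
    a walk. *)
Lemma conn_in_ind S a (Q : gV G -> Prop) : Q a ->
    (forall x, conn_in S a (sinit x) -> Q (sinit x) -> sE S x.1 ->
       sV S (sterm x) -> Q (sterm x)) ->
  forall v, conn_in S a v -> Q v.
Proof.
move=> Qa Qstep v [w []]; elim/last_ind: w v => [|w x IH] v.
  by move=> _ /= <-.
rewrite wend_rcons -cats1 is_walk_cat /= andbT => /andP[ww /eqP we] <- Sa Sw.
have Sw' y : List.In y w -> sE S y.1 /\ sV S (sterm y).
  by move=> yw; apply: Sw; apply/InP; rewrite mem_cat; apply/orP; left; apply/InP.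
have /Sw [Sx Sx'] : List.In x (w ++ [:: x]) by apply/InP; rewrite mem_cat mem_head orbT.
apply: Qstep => //; first by exists w; split.
exact: IH.
Qed.

Lemma conn_in_closed S a x : conn_in S a (sinit x) -> sE S x.1 ->
  sV S (sterm x) -> sE (component S a) x.1.
Proof.
move=> ax Sx Sx'; have ax' := conn_in_step ax Sx Sx'.
by move: ax ax'; rewrite /sinit /sterm /=; case: x.2.
Qed.

Lemma conn_in_component S a v : conn_in S a v -> conn_in (component S a) a v.
Proof.
move=> av; move: (av); elim/conn_in_ind: v / av => [/conn_in_start Sa|x ax IH Sx Sx' ax'].
  by apply: conn_in_refl; apply: conn_in_refl.
by apply: conn_in_step; [exact: IH|exact: conn_in_closed|].
Qed.

Lemma span_vertices v w u :
  u \in v :: map (@sterm G) w <-> u = v \/ exists2 x, List.In x w & u = sterm x.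
Proof.
rewrite inE; split=> [/orP[/eqP|/mapP[x /InP xw ->]]|[->|[x /InP xw ->]]].
- by left.
- by right; exists x.
- by rewrite eqxx.
- by rewrite map_f ?orbT.
Qed.

End Walks.

(** * Lifting paths and factorizations along a minor model *)

Section MinorModel.
Variables D G : graph.

(* A vertex [v] of [G] outside the model has [phi v = None]; the branch set of
   [u] is [phi @^-1 (Some u)], spanned by the contracted edges [K]; [sg] marks
   the reversed edges. *)
Record minor_model (phi : gV G -> option (gV D)) (fE : gE D -> gE G)
    (sg : pred (gE D)) (K : pred (gE G)) : Prop := MinorModel {
  mm_surj : forall u, exists v, phi v = Some u;
  mm_inj : injective fE;
  mm_notK : forall d, ~~ K (fE d);
  mm_init : forall d b,
    phi (sinit (fE d, b (+) sg d)) = Some (sinit (d, b));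
  mm_fiber : forall k, K k -> phi (gsrc k) = phi (gtgt k);
  mm_conn : forall s t u, phi s = Some u -> phi t = Some u ->
    exists w, [/\ is_walk s w, wend s w = t & all (fun x => K x.1) w];
  mm_forest : forall (A : zmodType) (g : gE G -> A), exists h : gV G -> A,
    forall k, K k -> g k = h (gtgt k) - h (gsrc k)
}.

Variables (phi : gV G -> option (gV D)) (fE : gE D -> gE G).
Variables (sg : pred (gE D)) (K : pred (gE G)).
Hypothesis M : minor_model phi fE sg K.

Let im (x : sedge D) : sedge G := (fE x.1, x.2 (+) sg x.1).
Let proj (w : seq (sedge G)) := [seq x <- w | ~~ K x.1].

Let phi_init x : phi (sinit (im x)) = Some (sinit x).
Proof. by case: x => d b; apply: (mm_init M). Qed.

Let phi_term x : phi (sterm (im x)) = Some (sterm x).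
Proof.
case: x => d b; have := mm_init M d (~~ b); rewrite /im /sinit /sterm /=.
by case: b; case: (sg d).
Qed.

Let K_fiber x : K x.1 -> phi (sinit x) = phi (sterm x).
Proof. by move/(mm_fiber M); rewrite /sinit /sterm; case: x.2. Qed.

Lemma lift_walk w s t u : is_walk u w -> phi s = Some u ->
  phi t = Some (wend u w) ->
  exists w', [/\ is_walk s w', wend s w' = t & proj w' = map im w].
Proof.
elim: w s u => [|x w IH] s u /=.
  move=> _ su tu; have [w [sw wt Kw]] := mm_conn M su tu; exists w; split=> //.
  by rewrite /proj; elim: w Kw {sw wt} => //= y w IH /andP[-> /IH].
case/andP=> /eqP xu xw su tw.
have [w1 [sw1 w1t Kw1]] := mm_conn M (etrans su (congr1 Some (esym xu))) (phi_init x).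
have [w2 [sw2 w2t pw2]] := IH _ _ xw (phi_term x) tw.
exists (w1 ++ im x :: w2); split.
- by rewrite is_walk_cat sw1 w1t /= eqxx.
- by rewrite wend_cat.
rewrite /proj filter_cat /= (mm_notK M) -/proj -/(proj w2) pw2.
suff -> : [seq x <- w1 | ~~ K x.1] = [::] by [].
by elim: w1 Kw1 {sw1 w1t} => //= y w1 IH1 /andP[-> /IH1].
Qed.

(** [mm_forest] makes every function on [K] a potential difference, as it is on a forest.
    Subtracting that difference from [g] kills [K], so only the projected words count; the
    correction depends only on the common ends. *)
Lemma abeq_lift s w1' w2' w1 w2 : is_walk s w1' -> is_walk s w2' ->
  wend s w1' = wend s w2' -> proj w1' = map im w1 -> proj w2' = map im w2 ->
  abeq w1 w2 -> abeq w1' w2'.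
Proof.
move=> sw1 sw2 e12 p1 p2 eq12 A g; have [h hK] := mm_forest M g.
pose g' e := g e - (h (gtgt e) - h (gsrc e)).
have g'K k : K k -> g' k = 0 by move=> /hK; rewrite /g' => ->; rewrite subrr.
have E w' w : proj w' = map im w ->
    evalw g' w' = evalw (fun d => if sg d then - g' (fE d) else g' (fE d)) w.
  move=> pw; have -> : evalw g' w' = evalw g' (proj w').
    rewrite /proj; elim: {pw} w' => //= x w' IH; rewrite evalw_cons IH.
    have [/g'K->|_] := boolP (K x.1); last by rewrite evalw_cons.
    by rewrite oppr0 if_same add0r.
  rewrite pw; elim: {pw} w => [|x w IH] /=; first by rewrite !evalw_nil.
  by rewrite !evalw_cons IH /=; case: x.2; case: (sg x.1); rewrite //= opprK.
have eg w' : is_walk s w' -> evalw g w' = evalw g' w' + (h (wend s w') - h s).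
  by move=> sw; rewrite /g' evalwB (evalw_potential h sw) subrK.
by rewrite (eg _ sw1) (eg _ sw2) e12 (E _ _ p1) (E _ _ p2) eq12.
Qed.

Definition over (p' : gpath G) (p : gpath D) :=
  [/\ phi (pstart p') = Some (pstart p), phi (pend p') = Some (pend p)
    & proj (pwalk p') = map im (pwalk p)].

Lemma over_exists s t (p : gpath D) : phi s = Some (pstart p) ->
  phi t = Some (pend p) ->
  exists p', [/\ over p' p, pstart p' = s & pend p' = t].
Proof.
move=> sp tp; have [w [sw wt pw]] := lift_walk (pvalid p) sp tp.
by exists (GPath sw); split=> //; split; rewrite /pend /= ?wt.
Qed.

(** Edges of [K] are exempt because no edge of [D] corresponds to them. *)
Definition projects (S' : subg G) (S : subg D) :=
  (forall v, sV S' v -> exists2 u, phi v = Some u & sV S u) /\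
  (forall g, sE S' g -> K g \/ exists2 d, g = fE d & sE S d).

Lemma over_span p' p : over p' p -> projects (span p') (span p).
Proof.
case: p' p => s w' sw' [u w uw] [/= su _ pw]; split=> [v|g] /=.
  move/span_vertices=> vw.
  suff [u' vu' u'w] : exists2 u', phi v = Some u' & u' \in u :: map (@sterm _) w.
    by exists u' => //; apply/span_vertices.
  elim: w' s u w sw' su uw pw vw => [|x w' IH] s u w /=.
    by move=> _ su _ _; rewrite inE => /eqP->; exists u; rewrite // mem_head.
  case/andP=> /eqP xs xw'.
  have [Kx|nKx] /= := boolP (K x.1).
    rewrite -xs (K_fiber Kx) => su uw pw; rewrite inE => /orP[/eqP->|].
      by exists u; rewrite ?mem_head // K_fiber.
    exact: IH.
  case: w => //= y w; rewrite -xs => xu /andP[/eqP yu yw] [xy pw].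
  rewrite inE => /orP[/eqP->|]; first by exists u; rewrite ?mem_head.
  have : phi (sterm x) = Some (sterm y) by rewrite xy phi_term.
  move/IH => /(_ w) H vw; have [//|//|//|u' vu' u'w] := H _ _ _ vw.
  by exists u'; rewrite // inE u'w orbT.
case=> b /InP gw; have [|nKg] := boolP (K g); [by left|right].
have : (g, b) \in proj w' by rewrite mem_filter /= nKg.
by rewrite pw => /mapP[[d c] dw [-> _]]; exists d => //; exists c; apply/InP.
Qed.

(** A walk in [S'] is followed edge by edge: an edge of [K] leaves the image vertex fixed, any other
    edge gives a step in [S]. *)
Lemma projects_component S' S s u : phi s = Some u -> projects S' S ->
  projects (component S' s) (component S u).
Proof.
move=> su [PV PE].
have C v : conn_in S' s v -> exists2 u', phi v = Some u' & conn_in S u u'.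
  move=> sv; move: (sv); elim/conn_in_ind: v / sv => [Ss|x sx IH Sx Sx' _].
    exists u => //; apply: conn_in_refl.
    by have [u' su' Su'] := PV _ (conn_in_start Ss); move: su'; rewrite su => -[->].
  have [u1 xu1 cu1] := IH sx; have [u2 xu2 Su2] := PV _ Sx'.
  have [Kx|[d xd Sd]] := PE _ Sx.
    by exists u1 => //; rewrite -K_fiber.
  exists u2 => //.
  have xim : x = im (d, x.2 (+) sg d).
    by rewrite /im /= -addbA addbb addbF -xd; case: (x).
  move: xu1 xu2; rewrite xim phi_init phi_term => -[ex1] [ex2].
  by rewrite -ex2; apply: conn_in_step; rewrite ?ex1 ?ex2.
split=> [v /C //|g [/PE[]]]; first by left.
move=> [d gd Sd] /C[u1 g1 c1] /C[u2 g2 c2]; right; exists d => //.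
move: g1 c1 g2 c2; have := phi_init (d, true); have := phi_init (d, false).
by rewrite /im /sinit /= -gd; case: (sg d) => /= -> -> [<-] ? [<-] ?; split.
Qed.

(** [C_0] and every [C_{n+1}] are intersections. If each member below has a member above lying over
    it, the intersections correspond, since [phi] gives one image per vertex and [fE] is injective.
    [i0] ensures that an image exists. *)
Lemma projects_bigcap (I I' : Type) (F' : I' -> subg G) (F : I -> subg D)
    (i0 : I) (S' : subg G) (S : subg D) :
  (forall i, exists2 i', projects (F' i') (F i) &
     (forall v, sV S' v -> sV (F' i') v) /\ (forall e, sE S' e -> sE (F' i') e)) ->
  (forall v, (forall i, sV (F i) v) -> sV S v) ->
  (forall e, (forall i, sE (F i) e) -> sE S e) ->
  projects S' S.
Proof.
move=> H HV HE; split=> [v S'v|g S'g].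
  have [i0' [P0 _] [V0 _]] := H i0; have [u vu _] := P0 _ (V0 _ S'v).
  exists u => //; apply: HV => i; have [i' [Pi _] [Vi _]] := H i.
  by have [u' vu' ] := Pi _ (Vi _ S'v); move: vu'; rewrite vu => -[->].
have [|nK] := boolP (K g); [by left|right].
have [i0' [_ P0] [_ E0]] := H i0.
have [Kg|[d gd _]] := P0 _ (E0 _ S'g); first by rewrite Kg in nK.
exists d => //; apply: HE => i; have [i' [_ Pi] [_ Ei]] := H i.
have [Kg|[d']] := Pi _ (Ei _ S'g); first by rewrite Kg in nK.
by rewrite gd => /(mm_inj M)->.
Qed.

Lemma over_chain s (p1 : gpath D) ps t : chained (p1 :: ps) ->
  phi s = Some (pstart p1) -> phi t = Some (pend (last p1 ps)) ->
  exists qs, [/\ List.Forall2 over qs (p1 :: ps),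
    is_walk s (flatten (map (@pwalk G) qs)),
    wend s (flatten (map (@pwalk G) qs)) = t,
    chained qs & if qs is q :: _ then pstart q = s else False].
Proof.
elim: ps s p1 => [|p2 ps IH] s p1.
  move=> _ sp tp; have [q [oq qs qt]] := over_exists sp tp.
  exists [:: q]; rewrite /= cats0 -qs; split=> //; last exact: pvalid.
  by constructor; [|constructor].
case/andP=> /eqP p12 pps sp tp.
(* Any vertex over the end of [p1] can serve as the junction of two lifted factors. *)
have [v vu] := mm_surj M (pend p1).
have [q [oq qs qv]] := over_exists sp vu.
have [qs' [F W E C]] := IH v p2 pps (etrans vu (congr1 Some p12)) tp.
case: qs' F W E C => // q' qs' F W E C q'v.
exists (q :: q' :: qs'); split=> //.
- by constructor.
- by rewrite [flatten _]/= is_walk_cat -{1}qs pvalid -qs -/(pend q) qv.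
- by rewrite [flatten _]/= wend_cat -qs -/(pend q) qv.
- by rewrite /= qv q'v eqxx.
Qed.

Lemma over_flatten qs ps : List.Forall2 over qs ps ->
  proj (flatten (map (@pwalk G) qs)) = map im (flatten (map (@pwalk D) ps)).
Proof.
by elim=> //= q p qs' ps' [_ _ pq] _ IH; rewrite /proj filter_cat map_cat -pq -IH.
Qed.

Lemma over_factorization p' p ps : over p' p -> factorization ps p ->
  exists2 qs, List.Forall2 over qs ps & factorization qs p'.
Proof.
case: ps => //= p1 ps [sp tp pp] [C ps1 pe eqp].
rewrite -ps1 in sp; rewrite -pe in tp.
have [qs [F W E Cq Q]] := over_chain C sp tp; exists qs => //.
case: qs F W E Cq Q => //= q qs F W E Cq qs'; split=> //.
  rewrite -E -qs' -/(pend q).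
  elim: qs q Cq {F W E qs'} => [|q2 qs IH] q /=; first by rewrite cats0.
  by case/andP=> /eqP q12 /IH ->; rewrite [RHS]wend_cat -[wend _ (pwalk q)]/(pend q) q12.
apply: (abeq_lift W (pvalid p') _ _ pp eqp); first exact: E.
exact: (over_flatten F).
Qed.

Lemma factorization1 (H : graph) (p : gpath H) : factorization [:: p] p.
Proof. by rewrite /= cats0; split. Qed.

(** Each representative or factorization of [p] lifts to one of [p'], so the intersection above is
    taken over at least these lifts. *)
Lemma Cn_over n p' p : over p' p -> projects (Cn n p') (Cn n p).
Proof.
elim: n p' p => [|n IH] p' p opp /=.
  pose I := {q | same_arrow q p}; pose I' := {q | same_arrow q p'}.
  pose F' (i : I') := span (sval i); pose F (i : I) := span (sval i).
  have i0 : I by exists p; split=> //; split.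
  apply: (projects_bigcap (F' := F') (F := F) i0) => //; first last.
  - by move=> v H q qp; apply: (H (exist _ q qp)).
  - by move=> v H q qp; apply: (H (exist _ q qp)).
  case=> q [qs [qe qa]]; case: (opp) => sp tp pp.
  rewrite -qs in sp; rewrite -qe in tp.
  have [q' [oq q's q'e]] := over_exists sp tp.
  have sq' : same_arrow q' p'.
    split=> //; split=> //; have [_ _ pq] := oq.
    apply: (abeq_lift (s := pstart p') _ (pvalid p') _ pq pp qa); last by rewrite -{1}q's; exact: q'e.
    by rewrite -q's pvalid.
  exists (exist _ q' sq'); first exact: over_span.
  by split=> v H; apply: H.
pose I := {ps | factorization ps p}; pose I' := {ps | factorization ps p'}.
pose U (H : graph) (ps : seq (gpath H)) :=
  Subg (fun v => exists2 q, List.In q ps & sV (Pn n q) v)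
       (fun e => exists2 q, List.In q ps & sE (Pn n q) e).
have i0 : I by exists [:: p]; exact: factorization1.
apply: (projects_bigcap (F' := fun i : I' => U G (sval i))
          (F := fun i : I => U D (sval i)) i0) => //; first last.
- by move=> v H ps fp; apply: (H (exist _ ps fp)).
- by move=> v H ps fp; apply: (H (exist _ ps fp)).
case=> ps fps; have [qs F fqs] := over_factorization opp fps.
exists (exist _ qs fqs); last by split=> v H; apply: H.
have {}IH q p0 : over q p0 -> projects (Pn n q) (Pn n p0).
  by move=> oq; case: (oq) => sq _ _; apply: projects_component => //; apply: IH.
rewrite /=; elim: F {fps fqs} => [|q p0 qs' ps' oq _ [IHV IHE]].
  by split=> v [].
have [PV PE] := IH _ _ oq; split=> v [q0 [<-|q0q]].
- by case/PV=> u; exists u => //; exists p0 => //; left.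
- move=> vq; have [|u vu [r rp ru]] := IHV v; first by exists q0.
  by exists u => //; exists r => //; right.
- by case/PE=> [Kv|[d vd pd]]; [left|right; exists d => //; exists p0 => //; left].
move=> vq; have [|Kv|[d vd [r rp rd]]] := IHE v; first by exists q0.
  by left.
by right; exists d => //; exists r => //; right.
Qed.

Lemma breaking_lift : (exists p : gpath D, breaking p) ->
  exists p : gpath G, breaking p.
Proof.
case=> p bp; have [s sp] := mm_surj M (pstart p); have [t tp] := mm_surj M (pend p).
have [p' [opp p's p't]] := over_exists sp tp; exists p' => H; apply: bp => n.
rewrite -p's in sp.
have [PV _] := projects_component sp (Cn_over n opp).
have [u] := PV _ (H n); rewrite p't tp => -[<-]; exact.
Qed.

End MinorModel.

(** * Minor operations as minor models *)

(** Nothing is contracted here, so one model serves isomorphisms, deletions and reversals; vertices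
    outside the image of [fV] get no image. *)
Lemma embedding_model (D G : graph) (fV : gV D -> gV G) (fE : gE D -> gE G)
    (sg : pred (gE D)) : injective fV -> injective fE ->
    (forall d, if sg d then gsrc (fE d) = fV (gtgt d) /\ gtgt (fE d) = fV (gsrc d)
               else gsrc (fE d) = fV (gsrc d) /\ gtgt (fE d) = fV (gtgt d)) ->
  minor_model (fun v => [pick u | fV u == v]) fE sg pred0.
Proof.
move=> injV injE H.
have phiV u : [pick u' | fV u' == fV u] = Some u.
  by case: pickP => [u' /eqP/injV->|/(_ u)]; rewrite ?eqxx.
split=> //.
- by move=> u; exists (fV u).
- move=> d b; have := H d; rewrite /sinit /=.
  by case: (sg d) => -[-> ->]; case: b; rewrite /= phiV.
- move=> s t u; case: pickP => // s' /eqP <- [->].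
  by case: pickP => // t' /eqP <- [->]; exists [::].
- by move=> A g; exists (fun=> 0).
Qed.

Lemma contraction_model (D G : graph) (e : gE G) (phi : gV G -> gV D)
    (fE : gE D -> gE G) : gsrc e <> gtgt e ->
    (forall y, exists x, phi x = y) ->
    (forall x y, phi x = phi y <->
       (x = y \/ (x = gsrc e /\ y = gtgt e) \/ (x = gtgt e /\ y = gsrc e))) ->
    injective fE ->
    (forall e', e' <> e <-> exists d, fE d = e') ->
    (forall d, gsrc d = phi (gsrc (fE d)) /\ gtgt d = phi (gtgt (fE d))) ->
  minor_model (fun v => Some (phi v)) fE pred0 (pred1 e).
Proof.
move=> nle surj fib injE imE H; split=> //.
- by move=> u; have [v <-] := surj u; exists v.
- by move=> d; apply/eqP/imE; exists d.
- by move=> d b; rewrite /sinit /= addbF; have [-> ->] := H d; case: b.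
- by move=> k /= /eqP->; congr Some; apply/fib; right; left.
- move=> s t u [<-] [/esym/fib[->|[[-> ->]|[-> ->]]]].
  + by exists [::].
  + by exists [:: (e, true)]; split; rewrite //= eqxx.
  + by exists [:: (e, false)]; split; rewrite //= eqxx.
(* The potential jumps by [g e] from [gsrc e] to [gtgt e], which is possible as [e] is not a
   loop. *)
- move=> A g; exists (fun v => if v == gtgt e then g e else 0) => k /= /eqP->.
  by rewrite eqxx; case: eqP => [/nle|]; rewrite // subr0.
Qed.

Lemma minor_breaking D G : minor D G ->
  (exists p : gpath D, breaking p) -> exists p : gpath G, breaking p.
Proof.
elim=> {D G} [D G [fV [fE [bV bE H]]]|D H G DH _ IH bD].
  apply: breaking_lift; apply: (@embedding_model _ _ fV fE pred0) => //.
    exact: bij_inj.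
  exact: bij_inj.
apply: IH; case: DH bD.
- move=> [e [fV [fE [bV injE _ E]]]]; apply: breaking_lift.
  by apply: (@embedding_model _ _ fV fE pred0) => //; exact: bij_inj.
- move=> [v [fV [fE [injV _ injE _ E]]]]; apply: breaking_lift.
  exact: (@embedding_model _ _ fV fE pred0).
- move=> [e [fV [fE [bV bE E]]]]; apply: breaking_lift.
  by apply: (@embedding_model _ _ fV fE (fun d => fE d == e)) => //; exact: bij_inj.
- move=> [e [phi [fE [nle [surj fib injE imE E]]]]]; apply: breaking_lift.
  exact: contraction_model nle surj fib injE imE E.
Qed.

(** * Breaking paths in the Theta graphs *)

(* The arrow of [c a] also factors as [c a b^-1 c^-1 . c b]. The closed walk [r]
   shows that [c] is not in [C0] of the first factor, which therefore
   contributes only the vertex [w]; so [C1] of [c a] has no edge but [c]. *)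
Lemma breaking_of_bypass (G : graph) (a b c : gE G) (r : seq (sedge G)) :
    gsrc a = gsrc b -> gtgt a = gtgt b -> gtgt c = gsrc a -> a <> b ->
    gsrc c <> gsrc a -> gsrc c <> gtgt a -> gsrc a <> gtgt a ->
    is_walk (gsrc c) r -> wend (gsrc c) r = gsrc c ->
    abeq r [:: (c, true); (a, true); (b, false); (c, false)] ->
    c \notin map fst r ->
  exists p : gpath G, breaking p.
Proof.
move=> sab tab ca ab wu wv uv wr er rq cr.
pose pw := [:: (c, true); (a, true)].
pose xw := [:: (c, true); (a, true); (b, false); (c, false)].
pose yw := [:: (c, true); (b, true)].
have wp : is_walk (gsrc c) pw by rewrite /= /sinit /sterm /= ca !eqxx.
have wx : is_walk (gsrc c) xw by rewrite /= /sinit /sterm /= ca sab tab !eqxx.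
have wy : is_walk (gsrc c) yw by rewrite /= /sinit /sterm /= ca sab !eqxx.
pose p := GPath wp; pose x := GPath wx; pose y := GPath wy.
have fac : factorization [:: x; y] p.
  split=> //=; first by rewrite /pend /= /sterm /= eqxx.
  move=> A f; rewrite !evalw_cons /= evalw_nil !addr0.
  by rewrite addKr addNr addr0.
have Cx e : sE (C0 x) e -> e = a \/ e = b.
  move=> Ce; have [|bx] := Ce x; first by do 2?split.
  have [|b' br] := Ce (GPath wr); first by do 2?split.
  case=> [[ec _]|[[-> _]|[[-> _]|[[ec _]|//]]]]; try by [left|right].
    by case/negP: cr; apply/mapP; exists (e, b'); [exact/InP|].
  by case/negP: cr; apply/mapP; exists (e, b'); [exact/InP|].
(* Neither [a] nor [b] meets the vertex [gsrc c]. *)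
have Px z : conn_in (C0 x) (gsrc c) z -> z = gsrc c.
  apply: (conn_in_ind (Q := fun z => z = gsrc c)) => // -[e b'] _ + /Cx/= ex _.
  by rewrite /sinit /sterm /=; case: ex => ->; case: b'; rewrite -?sab -?tab => /esym.
(* The single factor [p] bounds [C1] by the edges [c] and [a]; the factorization into [x] and [y]
   then excludes [a], which is not at [gsrc c] and not in [y]. *)
have C1 e : sE (Cn 1 p) e -> e = c.
  move=> Ce; have [q [<-|//] [/= Cpe _ _]] := Ce _ (factorization1 p).
  have [|b' /=] := Cpe p; first by do 2?split.
  case=> [[-> //]|[[ea _]|//]].
  have [q' /= [<-|[<-|//]]] := Ce _ fac.
    by rewrite -ea => -[_ /Px/esym].
  case=> Cye _ _; have [|b2 /=] := Cye y; first by do 2?split.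
  by rewrite -ea; case=> [[-> //]|[[/esym/ab]|//]].
exists p => /(_ 1); rewrite /pend /= => H.
(* With [c] alone, only [gsrc c] and [gtgt c = gsrc a] are reached, and [gtgt a] is neither. *)
have : gtgt a = gsrc c \/ gtgt a = gsrc a; last by case=> /esym.
elim/(@conn_in_ind G (Cn 1 p) (gsrc c)): (gtgt a) / H => [|[e b'] _ _ /C1/= -> _]; first by left.
by rewrite /sterm /=; case: b'; [right|left].
Qed.

Lemma theta_tuvw : [/\ tu <> tv, tw <> tu & tw <> tv].
Proof. by split=> /(congr1 val); rewrite /= !inordK. Qed.

Lemma breaking_theta1 : exists p : gpath Theta1, breaking p.
Proof.
have [uv wu wv] := theta_tuvw.
pose e k : gE Theta1 := inord k.
have vE k : (k < 4)%N -> val (e k) = k by move=> ?; rewrite /= inordK.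
have [s t] : (forall k, (k < 4)%N -> theta1_src (e k) = match k with 0 | 1 => tu | _ => tw end)
   /\ (forall k, (k < 4)%N -> theta1_tgt (e k) = match k with 0 | 1 => tv | 2 => tu | _ => tv end).
  by split=> k k4; rewrite /= /theta1_src /theta1_tgt vE.
have ne i j : (i < 4)%N -> (j < 4)%N -> e i = e j -> i = j.
  by move=> i4 j4 /(congr1 val); rewrite !vE.
(* The closed walk [d b^-1 a d^-1] has the exponents of [c a b^-1 c^-1] but reaches [a] and [b]
   through [d]. *)
apply: (@breaking_of_bypass Theta1 (e 0) (e 1) (e 2)
  [:: (e 3, true); (e 1, false); (e 0, true); (e 3, false)]);
  rewrite /= ?s ?t //.
- by move/ne; move=> /(_ isT isT).
- by rewrite /= /sinit /sterm /= !s // !t // !eqxx.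
- by rewrite /= /sterm /= s.
- move=> A f; rewrite !evalw_cons evalw_nil /= !addr0.
  by rewrite addrC !addrA subrK addrC [RHS]addrC !addrA addNr add0r.
- by rewrite !inE /=; do ![apply/norP; split]; rewrite //; apply/eqP => /ne; move=> /(_ isT isT).
Qed.

Lemma breaking_theta2 : exists p : gpath Theta2, breaking p.
Proof.
have [uv wu wv] := theta_tuvw.
pose e k : gE Theta2 := inord k.
have vE k : (k < 4)%N -> val (e k) = k by move=> ?; rewrite /= inordK.
have [s t] : (forall k, (k < 4)%N -> theta2_src (e k) = match k with 0 | 1 => tu | _ => tw end)
   /\ (forall k, (k < 4)%N -> theta2_tgt (e k) = match k with 0 | 1 => tv | _ => tu end).
  by split=> k k4; rewrite /= /theta2_src /theta2_tgt vE.
have ne i j : (i < 4)%N -> (j < 4)%N -> e i = e j -> i = j.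
  by move=> i4 j4 /(congr1 val); rewrite !vE.
(* Here [d] ends at [u] like [c], so the closed walk is [d a b^-1 d^-1]. *)
apply: (@breaking_of_bypass Theta2 (e 0) (e 1) (e 2)
  [:: (e 3, true); (e 0, true); (e 1, false); (e 3, false)]);
  rewrite /= ?s ?t //.
- by move/ne; move=> /(_ isT isT).
- by rewrite /= /sinit /sterm /= !s // !t // !eqxx.
- by rewrite /= /sterm /= s.
- move=> A f; rewrite !evalw_cons evalw_nil /= !addr0.
  by rewrite addrC !addrA subrK [RHS]addrC !addrA addNr add0r.
- by rewrite !inE /=; do ![apply/norP; split]; rewrite //; apply/eqP => /ne; move=> /(_ isT isT).
Qed.

(** * Building minors by single operations *)

Lemma graph_iso_refl G : graph_iso G G.
Proof. by exists id, id; split=> //; exists id. Qed.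

(** [minor_trans] adds steps at the small end; constructions from [G] downwards need them at the
    large end. In the base case the isomorphism is composed with the step. *)
Lemma minor_step_r D G' G : minor D G' -> minor_step G' G -> minor D G.
Proof.
elim=> {D G'} [D G' [fV [fE [bV bE H]]] st|D H G' DH _ IH /IH]; last exact: minor_trans.
apply: (minor_trans (H := G)); last exact/minor_refl/graph_iso_refl.
have [iE EK KE] := bE; have [iV VK KV] := bV.
have injE := bij_inj bE; have injV := bij_inj bV.
case: st => [[e [gV' [gE' [bgV injgE imE E]]]]|[v [gV' [gE' [injgV imV injgE imE E]]]]
            |[e [gV' [gE' [bgV bgE E]]]]|[e [phi [gE' [nle [surj fib injgE imE E]]]]]].
- constructor 1; exists e, (gV' \o fV), (gE' \o fE); split.
  + exact: bij_comp.
  + exact: inj_comp.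
  + move=> e'; rewrite imE; split=> -[d <-]; last by exists (fE d).
    by exists (iE d); rewrite /= KE.
  + by move=> d /=; have [-> ->] := E (fE d); have [-> ->] := H d.
- constructor 2; exists v, (gV' \o fV), (gE' \o fE); split.
  + exact: inj_comp.
  + move=> v'; rewrite imV; split=> -[d <-]; last by exists (fV d).
    by exists (iV d); rewrite /= KV.
  + exact: inj_comp.
  + move=> e'; rewrite imE; split=> -[d <-]; last by exists (fE d).
    by exists (iE d); rewrite /= KE.
  + by move=> d /=; have [-> ->] := E (fE d); have [-> ->] := H d.
- constructor 3; exists e, (gV' \o fV), (gE' \o fE); split.
  + exact: bij_comp.
  + exact: bij_comp.
  + by move=> d /=; have := E (fE d); have [-> ->] := H d.
- constructor 4; exists e, (iV \o phi), (gE' \o fE); split=> //; split.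
  + by move=> y; have [x xy] := surj (fV y); exists x; rewrite /= xy VK.
  + by move=> x y; rewrite -fib; split=> [/(can_inj KV)|/= ->].
  + exact: inj_comp.
  + move=> e'; rewrite imE; split=> -[d <-]; last by exists (fE d).
    by exists (iE d); rewrite /= KE.
  + move=> d /=; have [<- <-] := E (fE d); have [-> ->] := H d.
    by rewrite !VK.
Qed.

Definition del_edge (G : graph) (e : gE G) : graph :=
  @Graph (gV G) {e' | e' != e} (fun d => gsrc (val d)) (fun d => gtgt (val d)).

Lemma del_edgeP (G : graph) (e : gE G) : minor_step (del_edge e) G.
Proof.
constructor 1; exists e, id, val; split=> //.
- by exists id.
- exact: val_inj.
- by move=> e'; split=> [/eqP ne|[d <-]]; [exists (Sub e' ne)|apply/eqP/(valP d)].
Qed.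

Definition reverse_edge (G : graph) (e : gE G) : graph :=
  @Graph (gV G) (gE G) (fun d => if d == e then gtgt d else gsrc d)
    (fun d => if d == e then gsrc d else gtgt d).

Lemma reverse_edgeP (G : graph) (e : gE G) : minor_step (reverse_edge e) G.
Proof.
constructor 3; exists e, id, id; split; try by exists id.
by move=> d /=; case: eqP.
Qed.

(** [gsrc e] represents the contracted edge, so the contraction lives on the vertices other than
    [gtgt e]. *)
Definition merge (G : graph) (e : gE G) (x : gV G) :=
  if x == gtgt e then gsrc e else x.

Lemma merge_neq (G : graph) (e : gE G) x :
  gsrc e != gtgt e -> merge e x != gtgt e.
Proof. by rewrite /merge; case: ifP => // /negbT. Qed.

Definition contract (G : graph) (e : gE G) (ne : gsrc e != gtgt e) : graph :=
  @Graph {x | x != gtgt e} {e' | e' != e}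
    (fun d => Sub (merge e (gsrc (val d))) (merge_neq (gsrc (val d)) ne))
    (fun d => Sub (merge e (gtgt (val d))) (merge_neq (gtgt (val d)) ne)).

Lemma merge_eq (G : graph) (e : gE G) x y : gsrc e != gtgt e ->
  merge e x = merge e y <->
  x = y \/ (x = gsrc e /\ y = gtgt e) \/ (x = gtgt e /\ y = gsrc e).
Proof.
move=> /eqP ne; rewrite /merge; case: eqP => [->|xe]; case: eqP => [->|ye].
- by split=> // _; left.
- split=> [<-|[/esym//|[[/esym//]|[_ ->//]]]]; by right; right.
- split=> [->|[//|[[->//]|[_ /esym]]]] //; by right; left.
- by split=> [->|[//|[[]|[]]]]; [left|..].
Qed.

Lemma contractP (G : graph) (e : gE G) (ne : gsrc e != gtgt e) :
  minor_step (contract ne) G.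
Proof.
constructor 4; exists e, (fun x => Sub (merge e x) (merge_neq x ne)), val.
split; first exact/eqP; split=> //.
- move=> [y yP]; exists y; apply: val_inj; rewrite /= /merge.
  by rewrite (negbTE yP).
- move=> x y; rewrite -(merge_eq x y ne); split=> [/(congr1 val)//|xy].
  exact: val_inj.
- exact: val_inj.
- by move=> e'; split=> [/eqP n|[d <-]]; [exists (Sub e' n)|apply/eqP/(valP d)].
Qed.

Definition same_ends (V : Type) (s t s' t' : V) :=
  s = s' /\ t = t' \/ s = t' /\ t = s'.

(** Misdirected edges are reversed one by one; their number is the measure. *)
Lemma bijective_minor (D G : graph) (fV : gV D -> gV G) (fE : gE D -> gE G) :
    bijective fV -> bijective fE ->
    (forall d, same_ends (gsrc (fE d)) (gtgt (fE d)) (fV (gsrc d)) (fV (gtgt d))) ->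
  minor D G.
Proof.
move=> bV bE.
pose bad (H : graph) (hV : gV D -> gV H) (hE : gE D -> gE H) :=
  [pred d | (gsrc (hE d) != hV (gsrc d)) || (gtgt (hE d) != hV (gtgt d))].
have [n] := ubnP #|bad G fV fE|.
elim: n G fV fE bV bE => // n IH G fV fE bV bE le_n ends.
case: (pickP (bad G fV fE)) => [d bd|good]; last first.
  apply: minor_refl; exists fV, fE; split=> // d.
  by have /norP[/negPn/eqP-> /negPn/eqP->] := negbT (good d).
apply: minor_step_r (reverse_edgeP (fE d)).
apply: (IH (reverse_edge (fE d)) fV fE) => //=.
  rewrite -ltnS; apply: leq_trans le_n; rewrite ltnS.
  apply: proper_card; apply/properP; split.
    apply/subsetP => d'; rewrite !inE /= (inj_eq (bij_inj bE)).
    case: (d' =P d) => // ->; move: bd; rewrite /=.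
    by case: (ends d) => -[-> ->]; rewrite !eqxx.
  exists d => //; rewrite !inE /= eqxx.
  by move: bd; rewrite /=; case: (ends d) => -[-> ->]; rewrite !eqxx.
move=> d'; have := ends d'; rewrite /=; case: (fE d' =P fE d) => // _ [|] [-> ->]; by [right|left].
Qed.

(** Edges outside the image of [fE] are deleted one at a time until [fE] is onto. *)
Lemma spanning_minor (D G : graph) (fV : gV D -> gV G) (fE : gE D -> gE G) :
    bijective fV -> injective fE ->
    (forall d, same_ends (gsrc (fE d)) (gtgt (fE d)) (fV (gsrc d)) (fV (gtgt d))) ->
  minor D G.
Proof.
have [n] := ubnP #|gE G|.
elim: n G fV fE => // n IH G fV fE le_n bV injE ends.
case: (pickP [pred e | e \notin codom fE]) => [e ne|all_im]; last first.
  apply: (bijective_minor bV _ ends); apply: inj_card_bij => //.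
  rewrite -(card_codom injE); apply: subset_leq_card.
  by apply/subsetP => e _; have /negbFE := all_im e.
have nE d : fE d != e by apply: contraNneq ne => <-; apply: codom_f.
apply: minor_step_r (del_edgeP e).
apply: (IH (del_edge e) fV (fun d => Sub (fE d) (nE d))) => //=.
- rewrite card_sig -ltnS; apply: leq_trans le_n; rewrite ltnS.
  by apply: proper_card; apply/properP; split; [exact/subsetP|exists e; rewrite // !inE eqxx].
- by move=> d d' /(congr1 val)/injE.
Qed.

(** * Theta pairs give Theta minors *)

Definition crosses (G : graph) (X : {set gV G}) (g : gE G) :=
  (gsrc g \in X) != (gtgt g \in X).

(** Connectedness of the graph without [e] and [f] is expressed by cuts, because cuts pull back
    along a contraction. *)
Definition theta_pair (G : graph) (e f : gE G) :=
  [/\ gsrc e != gtgt e, gsrc f != gtgt f,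
      ~ same_ends (gsrc e) (gtgt e) (gsrc f) (gtgt f)
    & forall (X : {set gV G}) x y, x \in X -> y \notin X ->
        exists g, [/\ g != e, g != f & crosses X g]].

(** Only the two ends of [g] are identified, and [X] separates them, while each of [e], [f] lies on
    one side; hence neither a loop nor a parallel pair can arise. *)
Lemma theta_pair_contract (G : graph) (e f g : gE G) (X : {set gV G})
    (ne : gsrc g != gtgt g) (ge : e != g) (gf : f != g) :
    theta_pair e f -> crosses X g -> ~~ crosses X e -> ~~ crosses X f ->
  theta_pair (G := contract ne) (Sub e ge) (Sub f gf).
Proof.
rewrite /crosses !negbK => -[/eqP le /eqP lf par cut] cg /eqP ce /eqP cf.
have ng : (gsrc g \in X) <> (gtgt g \in X) by exact/eqP.
have mE x y : merge g x = merge g y -> x = y \/ ((x \in X) <> (y \in X) /\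
    (x = gsrc g /\ y = gtgt g \/ x = gtgt g /\ y = gsrc g)).
  case/(merge_eq _ _ ne)=> [|[[-> ->]|[-> ->]]]; first by left.
    by right; split; [|left].
  by right; split; [exact/nesym|right].
split.
- by apply/eqP=> /(congr1 val)/mE[//|[]].
- by apply/eqP=> /(congr1 val)/mE[//|[]].
- case=> -[/(congr1 val)/mE A /(congr1 val)/mE B].
    case: A B => [A|[xA A]] [B|[xB B]]; first by apply: par; left.
    + by apply: xB; rewrite -cf -ce A.
    + by apply: xA; rewrite cf ce B.
    + move: le xA xB ce cf; case: A B => -[-> ->] [] [-> ->] //; congruence.
  case: A B => [A|[xA A]] [B|[xB B]]; first by apply: par; right.
  + by apply: xB; rewrite cf -ce A.
  + by apply: xA; rewrite -cf ce B.
  + move: le xA xB ce cf; case: A B => -[-> ->] [] [-> ->] //; congruence.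
(* A cut of the contraction pulls back to a cut [Z] that [g] does not cross, so the edge found
   survives. *)
move=> Y x y xY yY; pose Z := [set v | Sub (merge g v) (merge_neq v ne) \in Y].
have inZ (v : gV (contract ne)) : (val v \in Z) = (v \in Y).
  rewrite inE; congr (_ \in Y); apply: val_inj => /=.
  by rewrite /merge (negbTE (valP v)).
have [|//|h [he hf cZ]] := cut Z (val x) (val y); rewrite ?inZ //.
have hg : h != g.
  apply: contraTneq cZ => ->; rewrite /crosses !inE negbK; apply/eqP.
  congr (_ \in Y); apply: val_inj; rewrite /= (merge_eq _ _ ne).
  by right; left.
by exists (Sub h hg); split=> //; rewrite /crosses !inE in cZ *.
Qed.

Lemma spanning_minor34 (s t : 'I_4 -> 'I_3) (G : graph) (xs : seq (gV G))
    (es : seq (gE G)) x0 e0 :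
    (#|gV G| <= 3)%N -> uniq xs -> size xs = 3 -> uniq es -> size es = 4 ->
    (forall i : 'I_4, same_ends (gsrc (nth e0 es i)) (gtgt (nth e0 es i))
                                (nth x0 xs (s i)) (nth x0 xs (t i))) ->
  minor (@Graph 'I_3 'I_4 s t) G.
Proof.
move=> V3 uxs sxs ues ses ends.
apply: (@spanning_minor (Graph s t) _ (fun i : 'I_3 => nth x0 xs i) (fun i : 'I_4 => nth e0 es i)) => //.
  apply: inj_card_bij; last by rewrite card_ord.
  by move=> i j /eqP; rewrite nth_uniq ?sxs // => /eqP/val_inj.
by move=> i j /eqP; rewrite nth_uniq ?ses // => /eqP/val_inj.
Qed.

(** Two non-loops on at most three vertices share an end, taken as [y]; not being parallel, they
    have different other ends. *)
Lemma theta_pair_consecutive (G : graph) (e f : gE G) : (#|gV G| <= 3)%N ->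
  theta_pair e f -> exists x y z, [/\ uniq [:: x; y; z],
    forall v, v \in [:: x; y; z], same_ends (gsrc e) (gtgt e) x y
    & same_ends (gsrc f) (gtgt f) y z].
Proof.
move=> V3 [le lf par _].
have no4 (s : seq (gV G)) : size s = 4 -> ~~ uniq s.
  move=> s4; apply/negP => /card_uniqP; rewrite s4 => c4.
  by have := max_card (mem s); rewrite c4 leqNgt ltnS V3.
have all3 (x y z : gV G) : uniq [:: x; y; z] -> forall v, v \in [:: x; y; z].
  move=> uxyz v; apply/negPn/negP => vN.
  by have /negP := no4 [:: v; x; y; z] erefl; case; rewrite cons_uniq vN.
suff [x [y [z [u ? ?]]]] : exists x y z, [/\ uniq [:: x; y; z],
    same_ends (gsrc e) (gtgt e) x y & same_ends (gsrc f) (gtgt f) y z].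
  by exists x, y, z; split=> //; exact: all3.
have [E1|N1] := eqVneq (gsrc e) (gsrc f).
  exists (gtgt e), (gsrc e), (gtgt f); split; [|by right|by left].
  rewrite /= !inE eq_sym (negbTE le) /= andbT E1 lf andbT.
  by apply/eqP => E2; apply: par; left.
have [E2|N2] := eqVneq (gsrc e) (gtgt f).
  exists (gtgt e), (gsrc e), (gsrc f); split; [|by right|by right].
  rewrite /= !inE eq_sym (negbTE le) /= andbT E2 (eq_sym (gtgt f)) lf andbT.
  by apply/eqP => E; apply: par; right.
have [E3|N3] := eqVneq (gtgt e) (gsrc f).
  exists (gsrc e), (gtgt e), (gtgt f); split; [|by left|by left].
  by rewrite /= !inE (negbTE le) (negbTE N2) E3 lf.
have [E4|N4] := eqVneq (gtgt e) (gtgt f).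
  exists (gsrc e), (gtgt e), (gsrc f); split; [|by left|by right].
  by rewrite /= !inE (negbTE le) (negbTE N1) E4 eq_sym lf.
have /negP[] := no4 [:: gsrc e; gtgt e; gsrc f; gtgt f] erefl.
by rewrite /= !inE !negb_or le N1 N2 N3 N4 lf.
Qed.

(** With [e] joining [x], [y] and [f] joining [y], [z], connectedness leaves at least two of the
    links [x y], [y z], [x z]. Links doubling both [e] and [f] give Theta_2; the other two choices
    give a triangle with one doubled side, which is Theta_1. *)
Lemma theta_pair_minor3 (G : graph) (e f : gE G) : (#|gV G| <= 3)%N ->
  theta_pair e f -> minor Theta1 G \/ minor Theta2 G.
Proof.
move=> V3 ef; have [x [y [z [xyz all3 exy fyz]]]] := theta_pair_consecutive V3 ef.
have [le lf par cut] := ef.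
pose link a b := exists g, [/\ g != e, g != f & same_ends (gsrc g) (gtgt g) a b].
have star a b c : a != b -> (forall v, v \in [:: a; b; c]) -> link a b \/ link a c.
  move=> ab allv.
  have [||g [ge gf]] := cut [set a] a b; rewrite ?inE 1?eq_sym //.
  rewrite /crosses !inE.
  have := allv (gsrc g); have := allv (gtgt g); rewrite !inE.
  case: (gtgt g =P a) => [ta _|_ /=].
    by case: (gsrc g =P a) => //= _ /orP[] /eqP s _; [left|right]; exists g; split=> //; right.
  case: (gsrc g =P a) => [sa|//] /=.
  by case/orP=> /eqP s _ _; [left|right]; exists g; split=> //; left.
have fe : e != f by apply/eqP => E; apply: par; rewrite E; left.
have [xy xz yz] : [/\ x != y, x != z & y != z].
  by move: xyz; rewrite /= !inE negb_or andbT => /andP[/andP[-> ->] ->].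
have perm3 (s : seq (gV G)) : perm_eq [:: x; y; z] s -> forall v, v \in s.
  by move=> p v; rewrite -(perm_mem p).
have allx : link x y \/ link x z by apply: star.
have ally : link y x \/ link y z.
  apply: star; first by rewrite eq_sym.
  by apply: perm3; rewrite (perm_catCA [:: x] [:: y] [:: z]).
have allz : link z x \/ link z y.
  apply: star; first by rewrite eq_sym.
  by apply: perm3; rewrite perm_sym -[X in perm_eq X _]/(rot 2 [:: x; y; z]) perm_rot.
have linkC a b : link a b -> link b a.
  by case=> g [ge gf gab]; exists g; split=> //; case: gab; [right|left].
have neq (g h : gE G) a b c d : same_ends (gsrc g) (gtgt g) a b ->
    same_ends (gsrc h) (gtgt h) c d -> ~~ ((a == c) && (b == d)) ->
    ~~ ((a == d) && (b == c)) -> g != h.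
  move=> gab hcd n1 n2; apply/eqP => gh; move: gab hcd; rewrite gh.
  case=> -[-> ->] [] [E1 E2]; by move: n1 n2; rewrite E1 E2 !eqxx.
have case1 : link x y -> link y z -> minor Theta2 G.
  case=> g [ge gf gxy] [h [he hf hyz]].
  have gh : g != h.
    by apply: (neq _ _ _ _ _ _ gxy hyz); rewrite ?(negbTE xy) ?(negbTE xz).
  (* The lists give the images of [u, v, w] and of the edges [a, b, c, d]. *)
  apply: (@spanning_minor34 _ _ _ [:: y; x; z] [:: e; g; f; h] x e) => //.
  - by rewrite /= !inE negb_or eq_sym xy yz xz.
  - by rewrite /= !inE !negb_or fe gf gh (eq_sym e g) ge (eq_sym e h) he (eq_sym f h) hf.
  - by case=> -[|[|[|[|//]]]] ? /=; rewrite /theta2_src /theta2_tgt /tu /tv /tw /= !inordK //=;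
    [case: exy|case: gxy|case: fyz|case: hyz]; by [left|right].
have case2 : link x y -> link x z -> minor Theta1 G.
  case=> g [ge gf gxy] [h [he hf hxz]].
  have gh : g != h.
    by apply: (neq _ _ _ _ _ _ gxy hxz); rewrite ?(negbTE yz) ?(negbTE xz) ?andbF.
  apply: (@spanning_minor34 _ _ _ [:: x; y; z] [:: e; g; h; f] x e) => //.
  - by rewrite /= !inE !negb_or fe gf gh hf (eq_sym e g) ge (eq_sym e h) he.
  - by case=> -[|[|[|[|//]]]] ? /=; rewrite /theta1_src /theta1_tgt /tu /tv /tw /= !inordK //=;
    [case: hxz|case: fyz]; by [left|right].
have case3 : link y z -> link x z -> minor Theta1 G.
  case=> g [ge gf gyz] [h [he hf hxz]].
  have gh : g != h.
    by apply: (neq _ _ _ _ _ _ gyz hxz); rewrite ?(eq_sym y x) ?(negbTE xy) ?(negbTE yz).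
  apply: (@spanning_minor34 _ _ _ [:: y; z; x] [:: f; g; e; h] x e) => //.
  - by rewrite /= !inE !negb_or (eq_sym y x) (eq_sym z x) xy yz xz.
  - by rewrite /= !inE !negb_or ge gh (eq_sym f g) gf (eq_sym f h) hf (eq_sym f e) fe (eq_sym e h) he.
  - by case=> -[|[|[|[|//]]]] ? /=; rewrite /theta1_src /theta1_tgt /tu /tv /tw /= !inordK.
case: allx => [lxy|lxz]; case: allz => [/linkC lxz'|/linkC lyz].
- by left; apply: case2.
- by right; apply: case1.
- case: ally => [/linkC lxy|lyz]; left; [exact: case2|exact: case3].
- by left; apply: case3.
Qed.

(** While four vertices remain, some [X] is crossed by neither edge: the ends of [e] if [f] avoids
    them, otherwise all ends of both, at most three vertices. An edge that crosses [X] is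
    contracted. *)
Lemma theta_pair_minor (G : graph) (e f : gE G) : theta_pair e f ->
  minor Theta1 G \/ minor Theta2 G.
Proof.
have [n] := ubnP #|gV G|; elim: n G e f => // n IH G e f le_n ef.
have [V3|V4] := leqP #|gV G| 3; first exact: theta_pair_minor3 ef.
have [le lf par cut] := ef.
have [X [x [y [xX yX ce cf]]]] : exists (X : {set gV G}) x y,
    [/\ x \in X, y \notin X, ~~ crosses X e & ~~ crosses X f].
  have [[sf tf]|dis] := pselect (gsrc f \notin [set gsrc e; gtgt e] /\
                                 gtgt f \notin [set gsrc e; gtgt e]).
    exists [set gsrc e; gtgt e], (gsrc e), (gsrc f).
    by rewrite /crosses (negbTE sf) (negbTE tf) !inE !eqxx orbT.
  (* [v] is the end of [f] that may lie off [e], so [X] contains all ends of [e] and [f]. *)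
  pose v := if gsrc f \in [set gsrc e; gtgt e] then gtgt f else gsrc f.
  pose X := [set gsrc e; gtgt e; v].
  have [XT|/eqP XT] := eqVneq X setT.
    have : (#|X| <= 3)%N.
      apply: leq_trans (leq_card_setU _ _) _; rewrite cards1 cards2.
      by case: (_ != _).
    by rewrite XT cardsT leqNgt V4.
  have /existsP[y yX] : [exists y, y \notin X].
    by apply: contra_notT XT => /existsPn H; apply/setP => z; rewrite in_setT; apply/negPn/H.
  exists X, (gsrc e), y; split=> //.
  - by rewrite !inE eqxx.
  - by rewrite /crosses !inE !eqxx /= orbT.
  have sX : gsrc f \in X.
    by rewrite /X /v in_setU in_set1; case: ifP => //; rewrite eqxx orbT.
  suff tX : gtgt f \in X by rewrite /crosses sX tX.
  rewrite /X /v in_setU in_set1; case: ifP => [_|/negbT sf]; first by rewrite eqxx orbT.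
  by apply/orP; left; apply/negPn/negP => tf; apply: dis.
have [g [ge gf cg]] := cut X x y xX yX.
have ne : gsrc g != gtgt g by apply: contraTneq cg => E; rewrite /crosses E eqxx.
rewrite eq_sym in ge; rewrite eq_sym in gf.
have efc := theta_pair_contract ne ge gf ef cg ce cf.
have [|m|m] := IH _ _ _ _ efc.
- rewrite card_sig -ltnS; apply: leq_trans le_n; rewrite ltnS.
  by apply: proper_card; apply/properP; split; [exact/subsetP|exists (gtgt g); rewrite // !inE eqxx].
- by left; apply: minor_step_r m (contractP ne).
- by right; apply: minor_step_r m (contractP ne).
Qed.

(** * Without theta pairs no path breaks *)

Section NonBreaking.
Variable G : graph.
Implicit Types (X Y : {set gV G}) (w : seq (sedge G)) (p q : gpath G).

Lemma walk_noncrossing X v w : is_walk v w ->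
  (forall x, x \in w -> ~~ crosses X x.1) -> (wend v w \in X) = (v \in X).
Proof.
elim: w v => //= x w IH v /andP[/eqP <- xw] H.
rewrite IH // => [|y yw]; last by apply: H; rewrite inE yw orbT.
have := H x (mem_head _ _); rewrite /crosses negbK /sinit /sterm.
by case: x.2 => /eqP ->.
Qed.

Lemma connected_crossing X x y : connected_graph G -> x \in X -> y \notin X ->
  exists g, crosses X g.
Proof.
move=> conn xX yX; apply: contrapT => H; have [w [xw wy]] := conn x y.
have := walk_noncrossing (X := X) xw; rewrite wy xX (negbTE yX) => C.
suff: false = true by []; apply: C => z _.
by apply/negP => cz; apply: H; exists z.1.
Qed.

Definition coef w (e : gE G) : int := evalw (fun g => (g == e)%:R) w.

Lemma evalw_coef (f : gE G -> int) w : evalw f w = \sum_g f g * coef w g.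
Proof.
elim: w => [|x w IH].
  by rewrite evalw_nil big1 // => g _; rewrite /coef evalw_nil mulr0.
rewrite evalw_cons IH; under [RHS]eq_bigr do rewrite /coef evalw_cons mulrDr.
rewrite big_split /=; congr (_ + _); rewrite (bigD1 x.1) //= eqxx.
rewrite big1 ?addr0 => [|g gx]; first by case: x.2; rewrite ?mulrN mulr1.
by rewrite eq_sym (negbTE gx) oppr0 if_same mulr0.
Qed.

(** The exponents form a flow from [v] to the end of the walk; the potential used is the indicator
    of [Y]. *)
Lemma coef_flow v w Y : is_walk v w ->
  \sum_g ((gtgt g \in Y)%:R - (gsrc g \in Y)%:R) * coef w g
    = (wend v w \in Y)%:R - (v \in Y)%:R.
Proof.
by move/(evalw_potential (fun u => (u \in Y)%:R : int)) <-; rewrite evalw_coef.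
Qed.

Lemma coef_mem w e : coef w e != 0 -> exists b, (e, b) \in w.
Proof.
elim: w => [|[g b] w IH]; first by rewrite /coef evalw_nil eqxx.
rewrite /coef evalw_cons /=; have [->|_] := eqVneq g e.
  by exists b; rewrite mem_head.
by rewrite oppr0 if_same add0r => /IH[b' ?]; exists b'; rewrite inE orbC; apply/orP; left.
Qed.

(* If [e] is not in the component [A] of [i], an edge [f] leaving [A] towards
   [e] would, together with [e], form a theta pair: [G - f] is connected because
   the walks of [avoid] reconnect its ends, and a cut whose only remaining edges
   are [e] and [f] carries no flow through [f], hence none through [e]. *)
Lemma component_flow_support (C : subg G) (i t : gV G) (c : gE G -> int) :
    connected_graph G -> (forall e f : gE G, ~ theta_pair e f) ->
    (forall Y, \sum_g ((gtgt g \in Y)%:R - (gsrc g \in Y)%:R) * c g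
       = (t \in Y)%:R - (i \in Y)%:R) ->
    sV C i ->
    (forall e, sE C e -> sV C (gsrc e) /\ sV C (gtgt e)) ->
    (forall e, gsrc e != gtgt e -> c e != 0 -> sE C e) ->
    (forall e f, gsrc e != gtgt e -> c e != 0 -> ~ sE C f ->
       exists w, [/\ is_walk i w, wend i w = gsrc e & f \notin map fst w]) ->
  conn_in C i t /\
  (forall e, gsrc e != gtgt e -> c e != 0 -> conn_in C i (gsrc e)).
Proof.
move=> conn noT flow Ci Cends Csupp avoid.
have [A AE] : exists A : {set gV G}, forall v, (v \in A) = `[< conn_in C i v >].
  by exists [set v | `[< conn_in C i v >]] => v; rewrite inE.
have inA v : reflect (conn_in C i v) (v \in A) by rewrite AE; exact: asboolP.
have loopN X g : crosses X g -> gsrc g != gtgt g.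
  by apply: contraTneq => E; rewrite /crosses E eqxx.
have CA g : sE C g -> ~~ crosses A g.
  move=> Cg; have [Cs Ct] := Cends _ Cg; rewrite /crosses negbK; apply/eqP.
  apply/inA/inA => Ag; first exact: (conn_in_step (x := (g, true))).
  exact: (conn_in_step (x := (g, false))).
have noflow g : crosses A g -> c g = 0.
  move=> cg; apply/eqP/negPn/negP => /(Csupp _ (loopN _ _ cg))/CA.
  by rewrite cg.
have iA : i \in A by apply/inA/conn_in_refl.
(* No flow crosses [A], so its net inflow is 0 and [t] lies with [i]. *)
have tA : t \in A.
  have := flow A; rewrite iA big1 => [|g _].
    by case: (t \in A).
  have [/noflow->|] := boolP (crosses A g); first by rewrite mulr0.
  by rewrite negbK => /eqP->; rewrite subrr mul0r.
split=> [|e le ce]; first exact/inA.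
apply/inA/negPn/negP => seA.
have teA : gtgt e \notin A.
  by apply: contra_neqN ce => teA; apply: noflow; rewrite /crosses teA (negbTE seA).
(* [W] is the component of [gsrc e] after removing [A]; an edge leaving [W] can only lead into
   [A]. *)
pose r : rel (gV G) := [rel x y | [&& x \notin A, y \notin A
  & [exists g, (gsrc g == x) && (gtgt g == y) || (gsrc g == y) && (gtgt g == x)]]].
pose W := [set v | connect r (gsrc e) v].
have WA v : v \in W -> v \notin A.
  rewrite inE => ev; have cl : closed r [pred v | v \notin A].
    by move=> x y /and3P[xA yA _]; rewrite !inE xA yA.
  by rewrite -[_ \notin A]/(v \in [pred v | v \notin A]) -(closed_connect cl ev).
have eW : gsrc e \in W by rewrite inE connect0.
have iW : i \notin W by apply: contraL iA => /WA.
have [f cfW] := connected_crossing conn eW iW.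
have [a [b [fab aA bW]]] : exists a b,
    [/\ same_ends (gsrc f) (gtgt f) a b, a \in A & b \in W].
  have stepW x y : r x y -> x \in W -> y \in W.
    by move=> rxy; rewrite !inE => /connect_trans; apply; exact: connect1.
  have [sfW|sfW] := boolP (gsrc f \in W); move: cfW; rewrite /crosses.
    rewrite sfW => tfW; exists (gtgt f), (gsrc f); split=> //; first by right.
    apply/negPn/negP => tfA; case/negP: tfW; rewrite eq_sym eqb_id.
    apply: (stepW _ _ _ sfW); rewrite /r /= WA // tfA; apply/existsP; exists f.
    by rewrite !eqxx.
  rewrite (negbTE sfW) eq_sym eqbF_neg negbK => tfW.
  exists (gsrc f), (gtgt f); split=> //; first by left.
  apply/negPn/negP => sfA; case/negP: sfW.
  apply: (stepW _ _ _ tfW); rewrite /r /= WA // sfA; apply/existsP; exists f.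
  by rewrite !eqxx orbT.
have bA := WA _ bW.
have cfA : crosses A f.
  by rewrite /crosses; case: fab => -[-> ->]; rewrite aA (negbTE bA).
have Cf : ~ sE C f by move/CA; rewrite cfA.
apply: (noT e f); split=> //; first exact: loopN cfA.
  move=> ef; have : gsrc f \notin A /\ gtgt f \notin A.
    by case: ef => -[<- <-].
  by case: fab => -[-> ->]; rewrite aA => -[].
move=> X x y xX yX; apply: contrapT => H.
have Xnc g : g != e -> g != f -> ~~ crosses X g.
  by move=> ge gf; apply/negP => cg; apply: H; exists g.
(* [X :\: A] contains neither [i] nor [t], and only [e] could carry flow across it. *)
have ceX : ~~ crosses X e.
  apply/negP => ceX; have := flow (X :\: A).
  rewrite !inE iA tA /= subrr (bigD1 e) //= big1 => [/eqP|g ge].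
    rewrite addr0 mulf_eq0 (negbTE ce) orbF !inE seA teA /=.
    by move: ceX; rewrite /crosses; case: (gsrc e \in X); case: (gtgt e \in X).
  have [/noflow->|] := boolP (crosses A g); first by rewrite mulr0.
  rewrite !inE /crosses negbK => /eqP sA.
  have [gf|gf] := eqVneq g f; first by move: cfA; rewrite /crosses -gf sA eqxx.
  have := Xnc _ ge gf; rewrite /crosses negbK => /eqP ->.
  by rewrite sA subrr mul0r.
(* Now only [f] can cross [X]. But its ends are on one side: [a] is joined to [i] inside [C], [i] to
   [gsrc e] by [avoid], and [gsrc e] to [b] inside [W], all without [f]. *)
have {}Xnc g : g != f -> ~~ crosses X g.
  by move=> gf; have [->|/Xnc->] := eqVneq g e.
have walkX v w : is_walk v w -> f \notin map fst w -> (wend v w \in X) = (v \in X).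
  move=> vw fw; apply: (walk_noncrossing vw) => z zw; apply: Xnc.
  by apply: contraNneq fw => <-; apply: map_f.
have aX : (a \in X) = (i \in X).
  have /inA[w [iw <- _ wC]] := aA; apply: walkX => //.
  by apply/mapP => -[z /InP/wC[Cz _] fz]; apply: Cf; rewrite fz.
have eX : (gsrc e \in X) = (i \in X).
  by have [w [iw <- fw]] := avoid e f le ce Cf; apply: walkX.
have bX : (b \in X) = (gsrc e \in X).
  have cl : closed r [pred v | v \in X].
    move=> v1 v2 /and3P[v1A v2A /existsP[g gv]]; rewrite !inE.
    have gf : g != f.
      apply: contraTneq aA => E; move: gv fab; rewrite E.
      by case/orP=> /andP[/eqP-> /eqP->] [[<- _]|[_ <-]].
    have := Xnc _ gf; rewrite /crosses negbK.
    by case/orP: gv => /andP[/eqP-> /eqP->] /eqP ->.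
  by move: bW; rewrite inE => /(closed_connect cl); rewrite !inE.
have [g] := connected_crossing conn xX yX; apply/negP.
have [->|/Xnc//] := eqVneq g f; rewrite /crosses negbK; apply/eqP.
by case: fab => -[-> ->]; rewrite aX bX eX.
Qed.

Lemma span_ends p e : sE (span p) e ->
  sV (span p) (gsrc e) /\ sV (span p) (gtgt e).
Proof.
case: p => v w vw [b /= /InP ebw]; rewrite /= -!span_vertices.
elim: w v vw ebw => // x w IH v /= /andP[/eqP xv xw]; rewrite !inE.
case/orP=> [/eqP E|/(IH _ xw)[]]; last first.
  by rewrite !inE => -> ->; rewrite !orbT.
by rewrite -xv -E /sinit /sterm /=; case: (b); rewrite !eqxx !orbT.
Qed.

Lemma Cn_ends n p e : sE (Cn n p) e ->
  sV (Cn n p) (gsrc e) /\ sV (Cn n p) (gtgt e).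
Proof.
case: n => [|n] /= H; first by split=> q /H/span_ends[].
by split=> ps /H[q qps [_ Hs Ht]]; exists q.
Qed.

(** The connecting walk can be chosen inside the component, so it cannot use [f]. *)
Lemma conn_in_avoid (S : subg G) a v f : conn_in S a v ->
  ~ sE (component S a) f ->
  exists w, [/\ is_walk a w, wend a w = v & f \notin map fst w].
Proof.
case/conn_in_component=> w [aw wv _ wS] nf; exists w; split=> //.
by apply/mapP => -[z /InP/wS[Sz _] fz]; apply: nf; rewrite fz.
Qed.

Lemma abeq_coef w1 w2 e : abeq w1 w2 -> coef w1 e = coef w2 e.
Proof. by apply. Qed.

Lemma coef_flatten ps e : coef (flatten (map (@pwalk G) ps)) e != 0 ->
  exists2 q, List.In q ps & coef (pwalk q) e != 0.
Proof.
elim: ps => [|q ps IH] /=; first by rewrite /coef evalw_nil eqxx.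
rewrite /coef evalw_cat -!/(coef _ _); have [E|] := eqVneq (coef (pwalk q) e) 0.
  by rewrite E add0r => /IH[q' q'ps]; exists q' => //; right.
by exists q => //; left.
Qed.

(** The walk is cut before [e], or after it if [e] is traversed backwards. *)
Lemma prefix_avoid v w e b f : is_walk v w -> (e, b) \in w ->
  f \notin map fst w ->
  exists w', [/\ is_walk v w', wend v w' = gsrc e & f \notin map fst w'].
Proof.
elim: w v b => // x w IH v b /= /andP[xv xw]; rewrite !inE negb_or.
case/orP=> [/eqP ex|ew] /andP[fx fw].
  case: b ex => ex.
    by exists [::]; split=> //=; move: xv; rewrite -ex => /eqP.
  by exists [:: x]; split; rewrite //= ?xv ?inE ?fx // -ex.
have [w' [xw' we fw']] := IH _ _ xw ew fw; exists (x :: w'); split=> //=.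
  by rewrite xv.
by rewrite inE negb_or fx.
Qed.

(** The edges of nonzero exponent are carried along because the flow argument at the next level
    needs them in the [P_n] of some factor. Each level is an instance of [component_flow_support],
    where the main point is to find the walks of [avoid]. *)
Lemma nonbreaking : connected_graph G ->
  (forall e f : gE G, ~ theta_pair e f) -> forall n p,
  conn_in (Cn n p) (pstart p) (pend p) /\
  (forall e, gsrc e != gtgt e -> coef (pwalk p) e != 0 ->
    sE (Cn n p) e /\ conn_in (Cn n p) (pstart p) (gsrc e)).
Proof.
move=> conn noT; elim=> [|n IH] p.
  have supp e : coef (pwalk p) e != 0 -> sE (Cn 0 p) e.
    move=> ce q [_ [_ qp]]; rewrite -(abeq_coef e qp) in ce.
    by have [b /InP eb] := coef_mem ce; exists b.
  have [||||Hp He] := @component_flow_support (Cn 0 p) (pstart p) (pend p)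
    (coef (pwalk p)) conn noT (fun Y => coef_flow Y (pvalid p)).
  - by move=> q [qp _]; left.
  - exact: Cn_ends.
  - by move=> e _ /supp.
  (* As [f] is not in [C0], some representative omits it; that representative still traverses [e],
     whose exponent is unchanged. *)
  - move=> e f _ ce Cf.
    have [q /not_implyP[qp qf]] : exists q, ~ (same_arrow q p -> sE (span q) f).
      exact/existsNP.
    have [qs [_ qa]] := qp; rewrite -(abeq_coef e qa) in ce.
    have [b eb] := coef_mem ce; rewrite -qs; apply: prefix_avoid (pvalid q) eb _.
    by apply/mapP => -[[g b'] /InP gq fg]; apply: qf; exists b'; rewrite fg.
  by split=> // e le ce; split; [exact: supp|exact: He].
have IHe q e : gsrc e != gtgt e -> coef (pwalk q) e != 0 -> sE (Pn n q) e.
  move=> le ce; have [_ /(_ e le ce)[Ce cs]] := IH q.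
  by apply: (conn_in_closed (x := (e, true))) => //; have [] := Cn_ends Ce.
have supp e : gsrc e != gtgt e -> coef (pwalk p) e != 0 -> sE (Cn n.+1 p) e.
  move=> le ce [//|p1 ps] [_ _ _ qa]; rewrite -(abeq_coef e qa) in ce.
  by have [q qps cq] := coef_flatten ce; exists q => //; apply: IHe.
have [||||Hp He] := @component_flow_support (Cn n.+1 p) (pstart p) (pend p)
  (coef (pwalk p)) conn noT (fun Y => coef_flow Y (pvalid p)).
- move=> [//|p1 ps] [_ <- _ _]; exists p1; first by left.
  by apply: conn_in_refl; apply: conn_in_start (IH p1).1.
- exact: Cn_ends.
- exact: supp.
(* Some factorization has [f] in no [P_n] of a factor. The walk runs through the [P_n] of the
   factors to the first in which [e] has nonzero exponent, and there to [gsrc e]. *)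
- move=> e f le ce Cf.
  have [ps /not_implyP[fac nf]] : exists ps, ~ (factorization ps p ->
      exists2 q, List.In q ps & sE (Pn n q) f) by exact/existsNP.
  case: ps fac nf => // p1 ps [C <- _ qa]; rewrite -(abeq_coef e qa) in ce.
  elim: ps p1 C ce {qa} => [|p2 ps IHps] p1 C ce nf;
    have nf1 : ~ sE (Pn n p1) f by move=> pf; apply: nf; exists p1; [left|].
    move: ce; rewrite /= cats0 => ce.
    by have [_ /(_ e le ce)[_ cs]] := IH p1; apply: conn_in_avoid cs nf1.
  have [c1|c1] := eqVneq (coef (pwalk p1) e) 0; last first.
    by have [_ /(_ e le c1)[_ cs]] := IH p1; apply: conn_in_avoid cs nf1.
  case/andP: C => /eqP p12 C.
  have [||w2 [pw2 we fw2]] := IHps p2 C.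
  - by move: ce; rewrite /= /coef evalw_cat -/(coef _ _) c1 add0r.
  - by case=> q qps qf; apply: nf; exists q => //; right.
  have [w1 [pw1 w1e fw1]] := conn_in_avoid (IH p1).1 nf1.
  exists (w1 ++ w2); split.
  - by rewrite is_walk_cat pw1 w1e p12.
  - by rewrite wend_cat w1e p12.
  - by rewrite map_cat mem_cat negb_or fw1.
by split=> // e le ce; split; [exact: supp|exact: He].
Qed.

Lemma breaking_theta_pair : connected_graph G -> (exists p, breaking p) ->
  exists e f : gE G, theta_pair e f.
Proof.
move=> conn [p bp]; apply: contrapT => noT; apply: bp => n.
apply: (nonbreaking conn _ n p).1 => e f ef; apply: noT; by exists e, f.
Qed.

End NonBreaking.

Theorem theorem4p1 (G : graph) :
  connected_graph G ->
  ((exists p : gpath G, breaking p) <-> minor Theta1 G \/ minor Theta2 G).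
Proof.
move=> conn; split=> [/(breaking_theta_pair conn)[e [f]]|].
  exact: theta_pair_minor.
by case=> /minor_breaking; apply; [exact: breaking_theta1|exact: breaking_theta2].
Qed.
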